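(* Let $p \geq 1$ be an integer, let $a = (a_k)_{k=1,\dots,p}$ and $b = (b_k)_{k=1,\dots,p}$ be two $p$-dimensional real vectors, and let $z_1,\dots,z_p$ be i.i.d. $N(0,1)$ random variables. Consider the random variable $$T = \sum_{k=1}^p \left( a_k z_k^2 + b_k z_k \right),$$ and put $a^{+} = \sup\{\sup_{k=1,\dots,p}\{a_k\},\, 0\}$ and $a^{-} = \sup\{\sup_{k=1,\dots,p}\{-a_k\},\, 0\}$. Then the following two concentration inequalities hold for all $x > 0$: $$\mathbb{P}\left[ T \geq \sum_{k=1}^p a_k + 2 \sqrt{\sum_{k=1}^p \left( a_k^2 + \frac{b_k^2}{2} \right)}\, \sqrt{x} + 2 a^{+} x \right] \leq \exp(-x),$$ $$\mathbb{P}\left[ T \leq \sum_{k=1}^p a_k - 2 \sqrt{\sum_{k=1}^p \left( a_k^2 + \frac{b_k^2}{2} \right)}\, \sqrt{x} - 2 a^{-} x \right] \leq \exp(-x).$$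
   Context: $N(0,1)$ denotes the standard Gaussian distribution on $\mathbb{R}$ (mean $0$, variance $1$).
   Formalization: The vectors a and b are assumed not both zero: if a = b = 0 then T = 0 and both thresholds are 0, so both probabilities equal 1 > exp(-x) and the claim as stated fails. *)

(* Defs.v *)
From HB Require Import structures.
From mathcomp Require Import all_boot all_order all_algebra.
From mathcomp Require Import all_classical all_reals all_analysis.

Set Implicit Arguments.
Unset Strict Implicit.
Unset Printing Implicit Defensive.

Import Order.TTheory GRing.Theory Num.Theory.

Local Open Scope classical_set_scope.
Local Open Scope ring_scope.
Local Open Scope ereal_scope.

(* Mutual (not merely pairwise) independence: the product rule is required
   for every subfamily [J] of the index type. *)
Definition independent_RVs (d d' : measure_display) (T : measurableType d)
    (T' : measurableType d') (R : realType) (P : probability T R)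
    (I : finType) (X : I -> {RV P >-> T'}) : Prop :=
  forall (J : {set I}) (A : I -> set T'),
    (forall i, i \in J -> measurable (A i)) ->
    P (\bigcap_(i in [set` J]) (X i @^-1` A i)) =
    \prod_(i in J) P (X i @^-1` A i).

(* Laws are compared on measurable sets only: [distribution P X] and
   [normal_prob 0 1] are total set functions, meaningless elsewhere. *)
Definition has_standard_normal_law (d : measure_display) (T : measurableType d)
    (R : realType) (P : probability T R) (X : {RV P >-> R}) : Prop :=
  forall A : set R, measurable A -> distribution P X A = normal_prob 0 1 A.

(* Main.v *)
(* Chernoff's method. Completing the square in the Gaussian integral gives, for
   2 a < 1,
     E exp(a z^2 + b z) = (1 - 2 a)^(-1/2) exp(b^2 / (2 (1 - 2 a))),
   and - ln(1 - u) <= u + u^2 / (2 (1 - c)) for u <= c < 1, 0 <= c, turns this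
   into E exp(a z^2 + b z) <= exp(a + (a^2 + b^2/2) / (1 - c)) when 2 a <= c.
   By independence, with V the sum of the a_k^2 + b_k^2/2 and c = a^+,
     ln E exp(t (T - sum a_k)) <= V t^2 / (1 - 2 c t),
   and t = sqrt x / (sqrt V + 2 c sqrt x) makes the Chernoff exponent exactly
   - x. The lower tail is the upper tail for (- a, - b). *)
Require Import Defs.
From HB Require Import structures.
From mathcomp Require Import all_boot all_order all_algebra.
From mathcomp Require Import all_classical all_reals all_analysis.
From mathcomp Require Import measurable_realfun.
From mathcomp Require Import ring lra.

Set Implicit Arguments.
Unset Strict Implicit.
Unset Printing Implicit Defensive.

Import Order.TTheory GRing.Theory Num.Theory HBNNSimple.
Import numFieldNormedType.Exports.

Local Open Scope classical_set_scope.
Local Open Scope ring_scope.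

(** * Integration under a change of measure, and products of independent factors *)

(** The last hypothesis is the conclusion for indicators; linearity extends it to simple functions
    and monotone convergence to [f]. It says that [nu] is the image under [X] of the measure with
    density [G]. It is used twice: with [X] the identity and [G] the Gaussian density, and with [G]
    a product of independent factors. *)
Lemma ge0_integral_change_of_measure (d d' : measure_display)
    (T : measurableType d) (T' : measurableType d') (R : realType)
    (mu : {measure set T -> \bar R}) (nu : {measure set T' -> \bar R})
    (X : T -> T') (G : T -> R) (f : T' -> R) :
  measurable_fun setT X -> measurable_fun setT G -> (forall x, 0 <= G x) ->
  measurable_fun setT f -> (forall y, 0 <= f y) ->
  (forall A, measurable A ->
     nu A = \int[mu]_x (\1_A (X x) * G x)%:E)%E ->
  (\int[nu]_y (f y)%:E = \int[mu]_x (f (X x) * G x)%:E)%E.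
Proof.
move=> mX mG G0 mf f0 nuE.
have mfE : measurable_fun setT (EFin \o f : T' -> \bar R) by exact/measurable_EFinP.
have mhX (h : T' -> R) : measurable_fun setT h ->
    measurable_fun setT (fun x => (h (X x) * G x)%:E).
  move=> mh; apply/measurable_EFinP/measurable_funM => //.
  exact: measurableT_comp.
have simple (h : {nnsfun T' >-> R}) :
    (\int[nu]_y (h y)%:E = \int[mu]_x (h (X x) * G x)%:E)%E.
  have hE y : (h y)%:E =
      (\sum_(r \in range h) (r * \1_(h @^-1` [set r]) y)%:E)%E.
    by rewrite fimfunE fsumEFin.
  under eq_integral do rewrite hE.
  have mh r : measurable (h @^-1` [set r]) by [].
  rewrite ge0_integral_fsum//; last 2 first.
  - by move=> r; apply/measurable_EFinP/measurable_funM.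
  - by move=> r y _; rewrite EFinM nnfun_muleindic_ge0.
  have hXE x : (h (X x) * G x)%:E =
      (\sum_(r \in range h) (r * \1_(h @^-1` [set r]) (X x) * G x)%:E)%E.
    rewrite EFinM hE ge0_mule_fsuml; last first.
      by move=> r; rewrite EFinM nnfun_muleindic_ge0.
    by under eq_fsbigr do rewrite -EFinM.
  under [RHS]eq_integral do rewrite hXE.
  rewrite ge0_integral_fsum//; last 2 first.
  - move=> r; apply: (mhX (fun y => r * \1_(h @^-1` [set r]) y)).
    exact: measurable_funM.
  - move=> r x _; rewrite EFinM mule_ge0 ?lee_fin// -lee_fin EFinM.
    exact: nnfun_muleindic_ge0.
  apply: eq_fsbigr => r; rewrite inE => -[y0 _ <-].
  under eq_integral do rewrite EFinM.
  under [RHS]eq_integral do rewrite -mulrA EFinM.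
  rewrite ge0_integralZl//; last 2 first.
  - by apply/measurable_EFinP; exact: measurable_indic.
  - by rewrite lee_fin.
  rewrite ge0_integralZl//; last 3 first.
  - by apply: mhX; exact: measurable_indic.
  - by move=> x _; rewrite lee_fin mulr_ge0.
  - by rewrite lee_fin.
  by rewrite integral_indic// setIT nuE.
(* Increasing simple approximations of [f]; multiplying by [G >= 0] keeps them increasing, so
   monotone convergence applies on both sides. *)
have cvgf y : (EFin \o (nnsfun_approx measurableT mfE)^~ y) @ \oo --> (f y)%:E.
  by apply: cvg_nnsfun_approx => // z _; rewrite lee_fin.
have nd y : {homo (fun n => nnsfun_approx measurableT mfE n y) :
    m n / (m <= n)%N >-> m <= n}.
  by move=> m n mn; have /lefP := nd_nnsfun_approx measurableT mfE mn; apply.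
have L := @cvg_monotone_convergence _ _ _ nu _ measurableT
   (fun n y => (nnsfun_approx measurableT mfE n y)%:E).
have M := @cvg_monotone_convergence _ _ _ mu _ measurableT
   (fun n x => (nnsfun_approx measurableT mfE n (X x) * G x)%:E).
have -> : (\int[nu]_y (f y)%:E =
    limn (fun n => \int[nu]_y (nnsfun_approx measurableT mfE n y)%:E))%E.
  rewrite (cvg_lim _ (L _ _ _))//.
  - by apply: eq_integral => y _; rewrite (cvg_lim _ (cvgf y)).
  - by move=> n; exact/measurable_EFinP.
  - by move=> n y _; rewrite lee_fin.
  - by move=> y _ m n mn; rewrite lee_fin nd.
under eq_fun do rewrite simple.
rewrite (cvg_lim _ (M _ _ _))//.
- apply: eq_integral => x _; apply: cvg_lim => //.
  under eq_fun do rewrite EFinM.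
  rewrite EFinM; apply: cvgeZr => //.
  exact: cvgf.
- by move=> n; apply: mhX.
- by move=> n x _; rewrite lee_fin mulr_ge0.
- by move=> x _ m n mn; rewrite lee_fin ler_wpM2r// nd.
Qed.

(** Independence is the case of indicators. With all factors but one fixed, both sides are integrals
    of the remaining factor against two measures, which agree as soon as they agree on measurable
    sets. *)
Lemma independent_RVs_integral_prod (d d' : measure_display)
    (T : measurableType d) (T' : measurableType d') (R : realType)
    (P : probability T R) (I : finType) (X : I -> {RV P >-> T'})
    (f : I -> T' -> R) :
  independent_RVs X ->
  (forall i, measurable_fun setT (f i)) -> (forall i y, 0 <= f i y) ->
  (forall i, \int[P]_w (f i (X i w))%:E < +oo)%E ->
  (\int[P]_w (\prod_i f i (X i w))%:E = \prod_i \int[P]_w (f i (X i w))%:E)%E.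
Proof.
move=> indX mf f0 foo.
have mX i : measurable_fun setT (X i : T -> T') by [].
have mfX (h : T' -> R) i : measurable_fun setT h ->
    measurable_fun setT (fun w => h (X i w)).
  by move=> mh; exact: measurableT_comp.
(* The factors are freed one at a time: outside [s] they are indicators. *)
have [s sP] : exists s : seq I, forall i, i \notin s ->
    exists2 A, measurable A & f i = \1_A.
  by exists (enum I) => i; rewrite mem_enum.
elim: s f mf f0 foo sP => [|j s IH] f mf f0 foo sP.
  (* Base case: every factor is an indicator, and their product is the indicator of the intersection
     of the events. *)
  have /choice[A AP] i : exists A : set T', measurable A /\ f i = \1_A.
    by have [//|A mA fA] := sP i; exists A.
  have mA i : measurable (A i) by case: (AP i).
  have fE i : f i = \1_(A i) by case: (AP i).
  have mXA i : measurable (X i @^-1` A i).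
    by rewrite -[X in measurable X]setTI; exact: mX.
  have EA i : (\int[P]_w (f i (X i w))%:E = P (X i @^-1` A i))%E.
    by rewrite fE -[in RHS](setIT (X i @^-1` A i)) -integral_indic.
  under eq_bigr do rewrite EA.
  have <- : (P (\bigcap_(i in [set` [set: I]%SET]) (X i @^-1` A i)) =
      \prod_i P (X i @^-1` A i))%E.
    by rewrite indX//; apply: eq_bigl => i; rewrite inE.
  set B := \bigcap_(i in _) _.
  have mB : measurable B by apply: fin_bigcap_measurable => //; exact: finite_finset.
  rewrite -[in RHS](setIT B) -integral_indic//.
  apply: eq_integral => w _; congr EFin; rewrite indicE.
  have [wB|/asboolPn wB] := pselect (B w).
    rewrite mem_set// big1// => i _; rewrite fE indicE mem_set//.
    by apply: wB; rewrite /= inE.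
  have [i wi] : exists i, ~ A i (X i w).
    by apply/existsNP => wA; move/asboolPn : wB; apply => i _; exact: wA.
  rewrite memNset; last exact/asboolPn.
  by rewrite (bigD1 i)//= fE indicE memNset// mul0r.
pose G w := \prod_(i | i != j) f i (X i w).
have mG : measurable_fun setT G.
  apply: (eq_measurable_fun
    (fun w => \prod_(i <- [seq i <- index_enum I | i != j]) f i (X i w))).
    by move=> w _; rewrite big_filter.
  by apply: measurable_prod => i _; exact: mfX.
pose c := (\prod_(i | i != j) \int[P]_w (f i (X i w))%:E)%E.
have c0 : (0 <= c)%E.
  by apply: prode_ge0 => i _; apply: integral_ge0 => w _; rewrite lee_fin.
(* Finiteness of the other expectations makes [c] a real scalar, so that [c] times the law of [X j]
   is a measure. *)
have cfin : c \is a fin_num.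
  apply: prode_fin_num => i _; rewrite ge0_fin_numE//.
  by apply: integral_ge0 => w _; rewrite lee_fin.
have fc0 : 0 <= fine c by rewrite fine_ge0.
have mEf : measurable_fun setT (fun y => (f j y)%:E) by exact/measurable_EFinP.
have fE0 y : (0 <= (f j y)%:E)%E by rewrite lee_fin.
rewrite (bigD1 j)//= -/c.
transitivity (
  \int[mscale (NngNum fc0) (distribution P (X j))]_y (f j y)%:E)%E; last first.
  rewrite ge0_integral_mscale//= fineK// muleC; congr (_ * _)%E.
  by rewrite ge0_integral_distribution.
under eq_integral do rewrite (bigD1 j)//= -/(G _).
rewrite -(@ge0_integral_change_of_measure _ _ T T' R P
  (mscale (NngNum fc0) (distribution P (X j))) (X j) G (f j))//.
  by move=> x; apply: prodr_ge0.
move=> A mA.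
have mXA : measurable (X j @^-1` A).
  by rewrite -[X in measurable X]setTI; exact: mX.
have EA : (\int[P]_w (\1_A (X j w))%:E = P (X j @^-1` A))%E.
  by rewrite -[in RHS](setIT (X j @^-1` A)) -integral_indic.
(* With the factor at [j] replaced by [\1_A], only indices in [s] may fail to be indicators, so the
   induction hypothesis gives equality of the two measures on [A]. *)
have := IH (fun i => if i == j then \1_A else f i).
rewrite (bigD1 j)//= eqxx.
have -> : (\prod_(i | i != j)
    \int[P]_w ((if i == j then \1_A else f i) (X i w))%:E = c)%E.
  by apply: eq_bigr => i /negPf ->.
rewrite EA.
under [X in _ -> _ = X]eq_integral.
  move=> w _; have -> : \1_A (X j w) * G w =
      \prod_i (if i == j then \1_A else f i) (X i w).
    rewrite (bigD1 j)//= eqxx; congr (_ * _).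
    by apply: eq_bigr => i /negPf ->.
  over.
move=> ->.
- by rewrite /mscale/= fineK// muleC.
- by move=> i; case: eqP => // _; exact: measurable_indic.
- by move=> i y; case: eqP.
- move=> i; case: eqP => // ->; rewrite EA.
  by apply: (le_lt_trans (probability_le1 P mXA)); rewrite ltry.
- move=> i iNs; case: eqP => [_|/eqP ij]; first by exists A.
  by apply: sP; rewrite inE negb_or ij.
Qed.

(** * Exponential moments of a Gaussian quadratic *)

Lemma standard_normal_integral_exp_quadratic (d : measure_display)
    (T : measurableType d) (R : realType) (P : probability T R)
    (X : {RV P >-> R}) (a b : R) :
  has_standard_normal_law X -> a < 2^-1 ->
  (\int[P]_w (expR (a * X w ^+ 2 + b * X w))%:E =
    ((Num.sqrt (1 - 2 * a))^-1 * expR (b ^+ 2 / (2 * (1 - 2 * a))))%:E)%E.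
Proof.
move=> lawX a2; set q := 1 - 2 * a; have q0 : 0 < q by rewrite /q; lra.
(* The right side is a constant plus the exponent of a normal density with mean [b / q] and variance
   [q^-1], whose total mass is 1. *)
have sqE (y : R) : a * y ^+ 2 + b * y + - (y - 0) ^+ 2 / 2 =
    b ^+ 2 / (2 * q) + - (y - b / q) ^+ 2 / (q^-1 *+ 2).
  have -> : a = (1 - q) / 2 by rewrite /q; field.
  by field; rewrite gt_eqF.
pose f (y : R) := expR (a * y ^+ 2 + b * y).
have mf : measurable_fun setT f.
  apply: measurableT_comp => //; apply: measurable_funD; apply: measurable_funM => //.
have f0 y : 0 <= f y by exact: expR_ge0.
transitivity (\int[distribution P X]_y (f y)%:E)%E.
  by rewrite ge0_integral_distribution//; exact/measurable_EFinP.
pose s := (Num.sqrt q)^-1.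
have s0 : 0 < s by rewrite invr_gt0 sqrtr_gt0.
have s2 : s ^+ 2 = q^-1 by rewrite exprVn sqr_sqrtr// ltW.
(* The factor [s] is the ratio of the peak of the standard density to that of the density with
   standard deviation [s]. *)
pose C := s * expR (b ^+ 2 / (2 * q)).
rewrite (@ge0_integral_change_of_measure _ _ _ _ R lebesgue_measure
   (distribution P X) id (normal_pdf 0 1) f)//; last 3 first.
- exact: measurable_normal_pdf.
- by move=> y; exact: normal_pdf_ge0.
- move=> A mA; transitivity (normal_prob 0 1 A); first exact: lawX.
  rewrite /normal_prob [LHS]integral_mkcond.
  apply: eq_integral => y _; rewrite patchE indicE.
  by case: ifP => _; rewrite ?mul1r ?mul0r.
transitivity (\int[lebesgue_measure]_y (C%:E * (normal_pdf (b / q) s y)%:E))%E.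
  apply: eq_integral => y _; rewrite -EFinM; congr EFin.
  rewrite !normal_pdfE ?oner_eq0 ?gt_eqF// /normal_peak /normal_fun.
  rewrite expr1n mul1r s2 -[q^-1 * _ *+ 2]mulrnAr sqrtrM ?invr_ge0 ?(ltW q0)//.
  rewrite sqrtrV ?(ltW q0)// -/s invfM.
  rewrite mulrCA -expRD /C.
  rewrite sqE expRD; field; rewrite !gt_eqF//.
  by rewrite sqrtr_gt0 mulrn_wgt0// pi_gt0.
rewrite ge0_integralZl//; last 3 first.
- by apply/measurable_EFinP; exact: measurable_normal_pdf.
- by move=> y _; rewrite lee_fin normal_pdf_ge0.
- by rewrite lee_fin mulr_ge0 ?expR_ge0// ltW.
by rewrite integral_normal_pdf mule1.
Qed.

(** The function [h] below equals 1 at 0, and its derivative has the sign of [v] on [v <= c],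
    because [2 * k * (1 - v) - 1 = 2 * k * (c - v)]. Hence 0 is a minimum of [h] there, which covers
    both signs of [u]. *)
Lemma one_sub_ge_expR (R : realType) (c u : R) : 0 <= c -> u <= c -> c < 1 ->
  expR (- (u + u ^+ 2 / (2 * (1 - c)))) <= 1 - u.
Proof.
move=> c0 uc c1; set k := (2 * (1 - c))^-1.
have kE : 2 * k * (1 - c) = 1 by rewrite /k; field; lra.
have k0 : 0 < k by rewrite invr_gt0; lra.
pose h (v : R) : R := (1 - v) * expR (v + v ^+ 2 * k).
have hD (v : R) : is_derive v 1 h
    (expR (v + v ^+ 2 * k) * (v * (2 * k * (1 - v) - 1))).
  apply: is_derive_eq; rewrite /GRing.scale/=; ring.
have ch : continuous h.
  by move=> v; apply/differentiable_continuous/derivable1_diffP; case: (hD v).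
have h0 : h 0 = 1 by rewrite /h expr0n/= mul0r addr0 expR0 subr0 mulr1.
suff : 1 <= h u.
  rewrite /h => /(ler_wpM2r (expR_ge0 (- (u + u ^+ 2 * k)))).
  by rewrite mul1r -(mulrA (1 - u)) -expRD subrr expR0 mulr1.
rewrite -h0; have [u0|u0] := leP 0 u.
  apply: (@ger0_derive1_ndecr R h 0 u _ _ _ 0 u (lexx 0) u0 (lexx u)) => //.
  - move=> v; rewrite in_itv/= => /andP[v0 vu].
    rewrite derive1E (@derive_val _ _ _ _ _ _ _ (hD v)).
    rewrite mulr_ge0 ?expR_ge0// mulr_ge0 ?(ltW v0)//; nra.
  - exact: continuous_subspaceT.
apply: (@ler0_derive1_nincr R h u 0 _ _ _ u 0 (lexx u) (ltW u0) (lexx 0)) => //.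
- move=> v; rewrite in_itv/= => /andP[uv v0].
  rewrite derive1E (@derive_val _ _ _ _ _ _ _ (hD v)).
  rewrite mulr_ge0_le0 ?expR_ge0// mulr_le0_ge0 ?(ltW v0)//; nra.
- exact: continuous_subspaceT.
Qed.

Lemma standard_normal_mgf_quadratic_le (d : measure_display)
    (T : measurableType d) (R : realType) (P : probability T R)
    (X : {RV P >-> R}) (a b c : R) :
  has_standard_normal_law X -> 0 <= c -> c < 1 -> 2 * a <= c ->
  (\int[P]_w (expR (a * X w ^+ 2 + b * X w))%:E <=
    (expR (a + (a ^+ 2 + b ^+ 2 / 2) / (1 - c)))%:E)%E.
Proof.
move=> lawX c0 c1 ac; rewrite standard_normal_integral_exp_quadratic//; last lra.
have c1' : 0 < 1 - c by lra.
have q0 : 0 < 1 - 2 * a by lra.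
have -> : expR (a + (a ^+ 2 + b ^+ 2 / 2) / (1 - c)) =
    expR (a + a ^+ 2 / (1 - c)) * expR (b ^+ 2 / (2 * (1 - c))).
  by rewrite -expRD; congr expR; field; rewrite gt_eqF.
rewrite lee_fin; apply: ler_pM; rewrite ?expR_ge0 ?invr_ge0 ?sqrtr_ge0//.
  (* Inverting and squaring reduces the first factor to [one_sub_ge_expR] at [u = 2 * a], where the
     exponent is [- 2 * (a + a ^+ 2 / (1 - c))]. *)
  rewrite -[leRHS]invrK lef_pV2 ?posrE ?invr_gt0 ?expR_gt0 ?sqrtr_gt0//.
  rewrite -expRN -(ler_pXn2r (n := 2)) ?nnegrE ?expR_ge0 ?sqrtr_ge0//.
  rewrite sqr_sqrtr ?(ltW q0)// -expRM_natl.
  apply: le_trans (one_sub_ge_expR c0 ac c1).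
  rewrite ler_expR le_eqVlt; apply/orP; left; apply/eqP.
  by field; rewrite gt_eqF.
rewrite ler_expR ler_wpM2l ?sqr_ge0// lef_pV2 ?posrE; nra.
Qed.

(** * Chernoff bound and the two tails *)

Lemma gaussian_quadratic_upper_tail (d : measure_display)
    (T : measurableType d) (R : realType) (P : probability T R) (I : finType)
    (z : I -> {RV P >-> R}) (a b : I -> R) (c x : R) :
  independent_RVs z -> (forall k, has_standard_normal_law (z k)) ->
  0 <= c -> (forall k, a k <= c) ->
  0 < \sum_k (a k ^+ 2 + b k ^+ 2 / 2) -> 0 < x ->
  (P [set w | (\sum_k a k
        + 2 * Num.sqrt (\sum_k (a k ^+ 2 + b k ^+ 2 / 2)) * Num.sqrt x
        + 2 * c * x <= \sum_k (a k * z k w ^+ 2 + b k * z k w))%R] <=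
    (expR (- x))%:E)%E.
Proof.
set v := \sum_k (_ + _) => indz lawz c0 ac v0 x0.
set s := _ + 2 * c * x.
pose Q w := \sum_k (a k * z k w ^+ 2 + b k * z k w).
have mQ : measurable_fun setT Q.
  apply: measurable_sum => k; apply: measurable_funD; apply: measurable_funM => //.
  exact: measurable_funX.
pose X : {RV P >-> R} := mfun_Sub (mem_set mQ).
pose sv := Num.sqrt v; pose sx := Num.sqrt x.
have sv0 : 0 < sv by rewrite sqrtr_gt0.
have sx0 : 0 < sx by rewrite sqrtr_gt0.
have svE : v = sv ^+ 2 by rewrite sqr_sqrtr// ltW.
have sxE : x = sx ^+ 2 by rewrite sqr_sqrtr// ltW.
pose D := sv + 2 * c * sx.
have D0 : 0 < D by rewrite ltr_wpDr// !mulr_ge0// ltW.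
(* This [t] minimizes [v * t ^+ 2 / (1 - 2 * c * t) - t * (s - \sum_k a k)] over [t >= 0] with
   [2 * c * t < 1]. The last inequality is strict at this [t] because [0 < v]. *)
pose t := sx / D.
have t0 : 0 < t by rewrite divr_gt0.
have tc : 1 - 2 * c * t = sv / D by rewrite /t /D; field; rewrite gt_eqF.
have tc1 : 2 * c * t < 1 by rewrite -subr_gt0 tc divr_gt0.
apply: le_trans (chernoff X s t0) _.
have -> : expR (- x) =
    expR (t * \sum_k a k + t ^+ 2 * v / (1 - 2 * c * t)) * expR (- (t * s)).
  rewrite -expRD tc; congr expR; rewrite /s -/sv -/sx svE sxE /t /D; field.
  by rewrite !gt_eqF.
rewrite EFinM lee_wpmul2r ?lee_fin ?expR_ge0//.
have -> : ('M_P X t = \int[P]_w (\prod_k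
    expR ((t * a k) * z k w ^+ 2 + (t * b k) * z k w))%:E)%E.
  rewrite /mmt_gen_fun unlock; apply: eq_integral => w _ /=.
  rewrite -expR_sum; congr (expR _)%:E; rewrite mulrC mulr_sumr.
  by apply: eq_bigr => k _; ring.
(* Used twice: for the finiteness required by the product formula, and for the final comparison of
   products. *)
have bound k : (\int[P]_w (expR (t * a k * z k w ^+ 2 + t * b k * z k w))%:E <=
   (expR (t * a k + ((t * a k) ^+ 2 + (t * b k) ^+ 2 / 2) /
      (1 - 2 * c * t)))%:E)%E.
  apply: standard_normal_mgf_quadratic_le => //.
    by rewrite mulr_ge0 ?(ltW t0)// mulr_ge0.
  by rewrite -[leRHS]mulrA ler_pM2l// [leRHS]mulrC ler_pM2l.
rewrite (independent_RVs_integral_prod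
  (f := fun k (y : R) => expR (t * a k * y ^+ 2 + t * b k * y)))//; last 2 first.
- move=> k; apply: measurableT_comp => //; apply: measurable_funD;
    exact: measurable_funM.
- by move=> k; apply: (le_lt_trans (bound k)); rewrite ltry.
have -> : (expR (t * \sum_k a k + t ^+ 2 * v / (1 - 2 * c * t)))%:E =
   (\prod_k (expR (t * a k + ((t * a k) ^+ 2 + (t * b k) ^+ 2 / 2) /
      (1 - 2 * c * t)))%:E)%E.
  rewrite prodEFin -expR_sum; congr (expR _)%:E.
  rewrite big_split/= -mulr_suml mulr_sumr; congr (_ + _ / _).
  by rewrite /v mulr_sumr; apply: eq_bigr => k _; ring.
pose M k := (\int[P]_w (expR (t * a k * z k w ^+ 2 + t * b k * z k w))%:E)%E.
(* Nonnegativity is carried through the induction, since multiplying inequalities in the extended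
   reals needs it. *)
suff [] : (0 <= \prod_k M k)%E /\ (\prod_k M k <=
    \prod_k (expR (t * a k + ((t * a k) ^+ 2 + (t * b k) ^+ 2 / 2) /
      (1 - 2 * c * t)))%:E)%E by [].
elim/big_ind2 : _ => [//|x1 x2 y1 y2 [? ?] [? ?]|k _].
- by split; [exact: mule_ge0|exact: lee_pmul].
- split; last exact: bound.
  by apply: integral_ge0 => w _; rewrite lee_fin expR_ge0.
Qed.

Theorem lemma0p1 (R : realType) (d : measure_display) (Omega : measurableType d)
    (P : probability Omega R) (p : nat) (hp : (1 <= p)%N)
    (a b : 'rV[R]_p) (hab : ~ (a = 0 /\ b = 0))
    (z : 'I_p -> {RV P >-> R})
    (hindep : independent_RVs z)
    (hlaw : forall k : 'I_p, has_standard_normal_law (z k)) :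
  let T := fun w : Omega =>
    \sum_(k < p) (a ord0 k * z k w ^+ 2 + b ord0 k * z k w) in
  let aplus := Num.max (sup (range (fun k : 'I_p => a ord0 k))) 0 in
  let aminus := Num.max (sup (range (fun k : 'I_p => - a ord0 k))) 0 in
  let v := \sum_(k < p) (a ord0 k ^+ 2 + b ord0 k ^+ 2 / 2) in
  forall x : R, 0 < x ->
    (P [set w | (T w >= \sum_(k < p) a ord0 k
                       + 2 * Num.sqrt v * Num.sqrt x + 2 * aplus * x)%R]
      <= (expR (- x))%:E)%E /\
    (P [set w | (T w <= \sum_(k < p) a ord0 k
                       - 2 * Num.sqrt v * Num.sqrt x - 2 * aminus * x)%R]
      <= (expR (- x))%:E)%E.
Proof.
move=> T aplus aminus v x x0.
(* Here [hab] enters. If [a] and [b] both vanish, [T] and both thresholds are 0, so both events have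
   probability 1 and the bounds fail. *)
have v0 : 0 < v.
  have ge0 k : 0 <= a ord0 k ^+ 2 + b ord0 k ^+ 2 / 2.
    by rewrite addr_ge0 ?sqr_ge0// divr_ge0 ?sqr_ge0.
  rewrite lt_neqAle sumr_ge0 ?andbT//; apply/eqP => /esym veq0.
  have {}veq0 k : a ord0 k = 0 /\ b ord0 k = 0.
    have := psumr_eq0P (fun k _ => ge0 k) veq0 (i := k) isT.
    move=> /eqP; rewrite paddr_eq0 ?sqr_ge0 ?divr_ge0 ?sqr_ge0//.
    rewrite sqrf_eq0 mulf_eq0 sqrf_eq0 invr_eq0 pnatr_eq0 orbF.
    by move=> /andP[/eqP -> /eqP ->].
  by apply: hab; split; apply/rowP => k; rewrite mxE; case: (veq0 k).
have le_max0_sup (u : 'I_p -> R) k : u k <= Num.max (sup (range u)) 0.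
  rewrite le_max; apply/orP; left; apply: ub_le_sup; last by exists k.
  (* A crude upper bound of the finite range, so that its [sup] dominates each value. *)
  exists (\sum_i `|u i|) => _ [i _ <-].
  by rewrite (bigD1 i)//= ler_wpDr ?ler_norm// sumr_ge0.
split.
  apply: (gaussian_quadratic_upper_tail (a := a ord0) (b := b ord0)) => //.
  by rewrite le_max lexx orbT.
(* The sum [v] is unchanged when [a] and [b] change sign, while [aminus] takes over the role of
   [aplus]. *)
have vN : v = \sum_k ((- a ord0 k) ^+ 2 + (- b ord0 k) ^+ 2 / 2).
  by apply: eq_bigr => k _; rewrite !sqrrN.
have := @gaussian_quadratic_upper_tail _ _ _ P _ z (fun k => - a ord0 k)
  (fun k => - b ord0 k) aminus x hindep hlaw.
rewrite -vN; set E := [set w | _]; set F := [set w | _] => tailN.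
have -> : F = E.
  apply/seteqP; split => w; rewrite /F /E /= /T.
    rewrite sumrN; under [X in _ -> _ <= X]eq_bigr do rewrite !mulNr -opprD.
    by rewrite sumrN; lra.
  rewrite sumrN; under [X in _ <= X -> _]eq_bigr do rewrite !mulNr -opprD.
  by rewrite sumrN; lra.
apply: tailN => //; first by rewrite /aminus le_max lexx orbT.
exact: (le_max0_sup (fun k => - a ord0 k)).
Qed.
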